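(* Every indecomposable solution $(X,r)$ whose permutation group $\mathcal{G}(X,r)$ is finite of square-free order is uniconnected.
   Context: A solution is a pair $(X,r)$ with $X$ a non-empty set and $r:X\times X\to X\times X$, $r(x,y)=(\sigma_x(y),\tau_y(x))$, such that $(r\times \mathrm{id})(\mathrm{id}\times r)(r\times \mathrm{id})=(\mathrm{id}\times r)(r\times \mathrm{id})(\mathrm{id}\times r)$ on $X^3$, $r^2=\mathrm{id}$ (involutive), and all maps $\sigma_x,\tau_y:X\to X$ are bijections (non-degenerate). The permutation group $\mathcal{G}(X,r)$ is the subgroup of $\mathrm{Sym}(X)$ generated by all $\sigma_x$. $(X,r)$ is indecomposable if $\mathcal{G}(X,r)$ acts transitively on $X$, and uniconnected if $\mathcal{G}(X,r)$ acts regularly on $X$. *)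

(* Defs.v *)
From mathcomp Require Import all_boot.
From mathcomp Require Import boolp classical_sets functions cardinality.

Set Implicit Arguments.
Unset Strict Implicit.
Unset Printing Implicit Defensive.

Local Open Scope classical_set_scope.

Section YangBaxter.
Variables (X : Type) (r : X * X -> X * X).

(* r (x, y) = (sigma r x y, tau r y x) *)
Definition sigma (x y : X) : X := (r (x, y)).1.
Definition tau (y x : X) : X := (r (x, y)).2.

(* r x id and id x r on X^3, encoded as (X * X) * X. *)
Definition r_id (t : X * X * X) : X * X * X := (r t.1, t.2).
Definition id_r (t : X * X * X) : X * X * X :=
  let: (x, y, z) := t in let: (y', z') := r (y, z) in (x, y', z').

Definition braid_relation : Prop :=
  r_id \o id_r \o r_id =1 id_r \o r_id \o id_r.

Definition nondegenerate : Prop :=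
  (forall x, bijective (sigma x)) /\ (forall y, bijective (tau y)).

Definition solution : Prop :=
  [/\ inhabited X, braid_relation, involutive r & nondegenerate].

End YangBaxter.

(* Permutations of an arbitrary type X are bijective functions X -> X, so a
   subgroup of Sym(X) is a set of functions. *)
Definition sym_subgroup (X : Type) (G : set (X -> X)) : Prop :=
  [/\ forall g, G g -> bijective g,
      G id,
      forall g h, G g -> G h -> G (g \o h) &
      forall g h, G g -> cancel g h -> cancel h g -> G h].

Definition permutation_group (X : Type) (r : X * X -> X * X) : set (X -> X) :=
  smallest (@sym_subgroup X) (range (sigma r)).

Definition acts_transitively (X : Type) (G : set (X -> X)) : Prop :=
  forall x y, exists2 g, G g & g x = y.

Definition acts_freely (X : Type) (G : set (X -> X)) : Prop :=
  forall g x, G g -> g x = x -> g = id.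

Definition acts_regularly (X : Type) (G : set (X -> X)) : Prop :=
  acts_transitively G /\ acts_freely G.

Definition indecomposable (X : Type) (r : X * X -> X * X) : Prop :=
  acts_transitively (permutation_group r).

Definition uniconnected (X : Type) (r : X * X -> X * X) : Prop :=
  acts_regularly (permutation_group r).

Definition square_free (n : nat) : Prop := forall d, d ^ 2 %| n -> d = 1.

Definition has_order (X : Type) (G : set (X -> X)) (n : nat) : Prop :=
  (G #= `I_n)%card.

(* Main.v *)
Require Import Defs.
From mathcomp Require Import all_boot.
From mathcomp Require Import boolp classical_sets functions cardinality.
From HB Require Import structures.
From mathcomp Require Import all_boot all_fingroup all_solvable.

(** Write x * y for the inverse of sigma_x applied to y. Involutivity and the
    braid relation say that sigma_x sigma_(x * y) is symmetric in x and y.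
    Because of this symmetry the maps
      t_x : g |-> g sigma_(g^-1 x)
    on the permutation group G commute with each other, and non-degeneracy
    makes them injective. They generate an abelian group A of permutations of
    the set G. The translation L_h by h in G satisfies
    L_h t_x L_h^-1 = t_(h x), so all translations normalise A; it follows that
    the orbit of 1 under A is closed under products, and as it contains every
    t_x(1) = sigma_x it is all of G. Being abelian, A acts regularly on G. This
    is the additive group of the brace attached to the solution (the element a
    of A corresponds to a(1) in G).

    Now let |G| = |A| be square-free. Then A is cyclic, and every subgroup of A
    is normalised by all translations. Suppose that g fixes x.
    - As G is transitive, all t_y are conjugate to t_x by translations, hence
      lie in the subgroup generated by t_x; so t_x generates A. Since L_g
      commutes with t_x, it centralises A, and a regular abelian group is its
      own centraliser: L_g belongs to A.
    - Therefore the subgroup generated by L_g is normalised by all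
      translations, that is, every conjugate of g is a power of g and fixes x.
      By transitivity g fixes every point, so g = 1.

    The group G is replaced below by an abstract finite group that acts on X on
    the right; its product is thus composition in the opposite order, and the
    translations L_h become right translations. *)

Set Implicit Arguments.
Unset Strict Implicit.
Unset Printing Implicit Defensive.

Import GroupScope.

(** * Finite groups *)

(** All Sylow subgroups have prime order, so an abelian group of square-free
    order is the direct product of cyclic groups of coprime orders. *)
Lemma abelian_square_free_cyclic (gT : finGroupType) (A : {group gT}) :
  square_free #|A| -> abelian A -> cyclic A.
Proof.
move=> sfA abA; apply: nil_Zgroup_cyclic; last exact: abelian_nil.
apply/forall_inP => P /SylowP[p p_pr sylP].
have oP := card_Hall sylP; rewrite p_part in oP.
have : (logn p #|A| <= 1)%N.
  rewrite leqNgt; apply/negP => lt1.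
  have := sfA p; rewrite (pfactor_dvdn 2 p_pr (cardG_gt0 A)) => /(_ lt1) p1.
  by rewrite p1 in p_pr.
case: (logn p #|A|) oP => [|[|//]] oP _.
  by rewrite (card1_trivg oP) cyclic1.
by apply: prime_cyclic; rewrite oP.
Qed.

(** Every subgroup of a cyclic group is characteristic. *)
Lemma cyclic_conj_cycle (gT : finGroupType) (A : {group gT}) (a l : gT) :
  cyclic A -> l \in 'N(A) -> a \in A -> a ^ l \in <[a]>.
Proof.
move=> cycA nAl Aa.
have ca : <[a]> \char A by rewrite sub_cyclic_char // cycle_subG.
have nal : l \in 'N(<[a]>).
  by rewrite -cycle_subG (char_norm_trans ca) // cycle_subG.
by rewrite memJ_norm // cycle_id.
Qed.

Section SelfCentralising.
Variables (T : finType) (A : {group {perm T}}) (x0 : T).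
Hypothesis abA : abelian A.
Hypothesis trA : forall y, exists2 a, a \in A & a x0 = y.

(** If [a] and [b] agree at [x0], they agree at its image under any [c] in [A],
    since they commute with [c]. *)
Lemma transitive_centraliser_eq (a b : {perm T}) :
  a \in 'C(A) -> b \in 'C(A) -> a x0 = b x0 -> a = b.
Proof.
move=> /centP Ca /centP Cb eqab; apply/permP => y.
have [c Ac <-] := trA y.
by rewrite -!permM -Ca // -Cb // !permM eqab.
Qed.

Lemma transitive_abelian_selfcent : 'C(A) = A :> {set {perm T}}.
Proof.
apply/eqP; rewrite eqEsubset [_ \subset 'C(A)]abA andbT.
apply/subsetP => l Cl.
have [a Aa al] := trA (l x0).
rewrite -(@transitive_centraliser_eq a l) //.
by apply: (subsetP abA).
Qed.

Lemma transitive_abelian_card : #|A| = #|T|.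
Proof.
have inj : {in A &, injective (fun a : {perm T} => a x0)}.
  by move=> a b Aa Ab; apply: transitive_centraliser_eq; apply: (subsetP abA).
rewrite -(card_in_imset inj) -cardsT; congr #|pred_of_set _|.
apply/setP => y; rewrite inE; have [a Aa <-] := trA y.
exact: imset_f.
Qed.

End SelfCentralising.

(** * The additive group of a solution *)

Section AdditiveGroup.
Variables (X : Type) (gT : finGroupType) (to : X -> gT -> X) (s : X -> gT).

Hypothesis to1 : forall x, to x 1 = x.
Hypothesis toM : forall x g h, to x (g * h) = to (to x g) h.

(** [to y (s x)] stands for sigma_x(y). The first hypothesis is the symmetry of
    sigma_x sigma_(x * y), the second the injectivity of x |-> x * x. *)
Hypothesis cycle_set : forall x y,
  s (to y (s x)^-1) * s x = s (to x (s y)^-1) * s y.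
Hypothesis diag_inj : injective (fun x => to x (s x)^-1).
Hypothesis s_gen : forall H : {group gT},
  (forall x, s x \in H) -> H = [set: gT] :> {set gT}.
Hypothesis transitive : forall x y, exists g, to x g = y.
Hypothesis faithful : forall g, (forall x, to x g = x) -> g = 1.

(** Addition of [s x] in the brace with multiplicative group [gT]. *)
Definition sum_fun (x : X) (g : gT) : gT := s (to x g^-1) * g.

Lemma sum_fun_inj x : injective (sum_fun x).
Proof.
move=> g h; rewrite /sum_fun => eqgh.
have : to x (s (to x g^-1) * g)^-1 = to x (s (to x h^-1) * h)^-1.
  by rewrite eqgh.
rewrite !invMg !toM => /diag_inj eqx.
by move: eqgh; rewrite eqx => /mulgI.
Qed.

Definition sum_perm x : {perm gT} := perm (@sum_fun_inj x).

Lemma sum_perm_comm x y : commute (sum_perm x) (sum_perm y).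
Proof.
apply/permP => g; rewrite !permM !permE /sum_fun !invMg !toM !mulgA.
by rewrite cycle_set.
Qed.

Definition rtrans (h : gT) : {perm gT} := perm (mulIg h).

Lemma rtransM g h : rtrans (g * h) = rtrans g * rtrans h.
Proof. by apply/permP => k; rewrite permM !permE mulgA. Qed.

Lemma rtransV g : rtrans g^-1 = (rtrans g)^-1.
Proof.
apply: (mulgI (rtrans g)); rewrite -rtransM !mulgV.
by apply/permP => k; rewrite permE perm1 mulg1.
Qed.

Lemma rtransX g k : rtrans (g ^+ k) = rtrans g ^+ k.
Proof.
elim: k => [|k IHk]; last by rewrite !expgS rtransM IHk.
by apply/permP => h; rewrite permE perm1 mulg1.
Qed.

Lemma rtransJ g h : rtrans (g ^ h) = rtrans g ^ rtrans h.
Proof. by rewrite /conjg !rtransM rtransV. Qed.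

Lemma rtrans_inj : injective rtrans.
Proof. by move=> g h /permP/(_ 1); rewrite !permE !mul1g. Qed.

Lemma sum_permJ x h : sum_perm x ^ rtrans h = sum_perm (to x h).
Proof.
apply/permP => g; rewrite /conjg -rtransV !permM !permE /sum_fun.
by rewrite invMg invgK toM -!mulgA mulVg mulg1.
Qed.

Variable x0 : X.

(** The generators are indexed by [gT] instead of the orbit [X] of [x0], to
    have a finite index type. *)
Definition additive_group : {set {perm gT}} :=
  <<[set sum_perm (to x0 g) | g : gT]>>.
Canonical additive_group_group := [group of additive_group].
Local Notation A := additive_group.

Lemma mem_sum_perm x : sum_perm x \in A.
Proof. by have [g <-] := transitive x0 x; apply/mem_gen/imset_f. Qed.

Lemma additive_group_abelian : abelian A.
Proof.
rewrite abelian_gen; apply/centsP => _ /imsetP[g _ ->] _ /imsetP[h _ ->].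
exact: sum_perm_comm.
Qed.

Lemma rtrans_norm h : rtrans h \in 'N(A).
Proof.
rewrite inE /additive_group -genJ gen_subG; apply/subsetP.
by move=> _ /imsetP[_ /imsetP[g _ ->] ->]; rewrite sum_permJ mem_sum_perm.
Qed.

(** The orbit of 1 is closed under products: if a(1) = g and b(1) = h, then the
    conjugate of a by the translation by h maps h to g h. *)
Lemma additive_group_transitive g : exists2 a, a \in A & a 1 = g.
Proof.
pose H := [set g | [exists (a | a \in A), a 1 == g]].
have HP h : reflect (exists2 a : {perm gT}, a \in A & a 1 = h) (h \in H).
  by rewrite inE; apply: (iffP exists_inP) => -[a Aa /eqP]; exists a => //; apply/eqP.
have gH : group_set H.
  apply/group_setP; split; first by apply/HP; exists 1; rewrite ?group1 ?perm1.
  move=> _ h /HP[a Aa <-] /HP[b Ab bh]; apply/HP; exists (b * a ^ rtrans h).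
    by rewrite groupM // memJ_norm // rtrans_norm.
  by rewrite /conjg -rtransV !permM bh !permE mulgV.
apply/HP; rewrite -[H]/(Group gH : {set gT}) s_gen ?inE // => x.
apply/HP; exists (sum_perm x); first exact: mem_sum_perm.
by rewrite permE /sum_fun invg1 to1 mulg1.
Qed.

Hypothesis sf : square_free #|gT|.

Lemma additive_group_cyclic : cyclic A.
Proof.
apply: abelian_square_free_cyclic additive_group_abelian.
by rewrite (transitive_abelian_card additive_group_abelian
              additive_group_transitive).
Qed.

(** In brace terms: [sum_perm x0] generates the additive group, so an element
    that fixes [x0] lies in the socle. *)
Lemma stabiliser_rtrans_additive g : to x0 g = x0 -> rtrans g \in A.
Proof.
move=> gx0.
have -> : A = 'C(A).
  by rewrite (transitive_abelian_selfcent additive_group_abelian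
                additive_group_transitive).
suff sA : A \subset <[sum_perm x0]>.
  apply: (subsetP (centS sA)); rewrite cent_cycle; apply/cent1P.
  by apply/commute_sym/commgP/conjg_fixP; rewrite sum_permJ gx0.
rewrite gen_subG; apply/subsetP => _ /imsetP[h _ ->].
rewrite -sum_permJ (cyclic_conj_cycle additive_group_cyclic) ?mem_sum_perm //.
exact: rtrans_norm.
Qed.

Lemma stabiliser_trivial g : to x0 g = x0 -> g = 1.
Proof.
move=> gx0.
have gJ h : to x0 (g ^ h) = x0.
  have /cycleP[k] := cyclic_conj_cycle additive_group_cyclic (rtrans_norm h)
                       (stabiliser_rtrans_additive gx0).
  rewrite -rtransJ -rtransX => /rtrans_inj ->.
  by elim: k => [|k IHk]; rewrite ?to1 // expgS toM gx0.
apply: faithful => x; have [h <-] := transitive x0 x.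
by rewrite -toM conjgCV toM gJ.
Qed.

End AdditiveGroup.

(** * Permutation groups as abstract groups *)

(** The group consists of indices for the elements of [G]; its product is
    composition in the opposite order, so that evaluation is a right action. *)
Lemma finite_sym_subgroup_action (X : Type) (G : set (X -> X)) (n : nat) :
    sym_subgroup G -> has_order G n ->
  exists (gT : finGroupType) (to : X -> gT -> X),
    [/\ #|gT| = n,
        (forall x, to x 1 = x) /\ (forall x g h, to x (g * h) = to (to x g) h),
        forall g : gT, G (to^~ g),
        forall f, G f -> exists g, to^~ g = f &
        forall g h : gT, to^~ g = to^~ h -> g = h].
Proof.
move=> [Gbij G1 GM GV] /card_set_bijP[f [fG finj fsurj]].
have /choice[e eP] (i : 'I_n) : exists u, G u /\ f u = i.
  by have [u Gu fu] := fsurj i (ltn_ord i); exists u.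
have Ge i : G (e i) := (eP i).1.
have einj : injective e.
  by move=> i j eij; apply: val_inj; rewrite /= -(eP i).2 eij (eP j).2.
have esurj u : G u -> exists i, e i = u.
  move=> Gu; exists (Ordinal (fG u Gu)).
  apply: finj; [exact: mem_set | exact: mem_set | exact: (eP _).2].
have [one one_e] := esurj id G1.
have /choice[mul2 mulP] (p : 'I_n * 'I_n) : exists k, e k = e p.2 \o e p.1.
  exact: esurj (GM _ _ (Ge _) (Ge _)).
pose mul i j := mul2 (i, j).
have mulE i j : e (mul i j) = e j \o e i := mulP (i, j).
have /choice[inv invP] (i : 'I_n) : exists k, e k \o e i = id /\ e i \o e k = id.
  have [v ev ve] := Gbij _ (Ge i).
  have [k ek] := esurj v (GV _ _ (Ge i) ev ve).
  by exists k; rewrite ek; split; apply/funext.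
have mulA : associative mul by move=> i j k; apply: einj; rewrite !mulE.
have mul1 : left_id one mul by move=> i; apply: einj; rewrite mulE one_e.
have mulV : left_inverse one inv mul.
  by move=> i; apply: einj; rewrite mulE one_e (invP i).2.
pose gT : finGroupType := HB.pack 'I_n (Finite_isGroup.Build 'I_n mulA mul1 mulV).
exists gT, (fun x g => e g x); split=> //; first exact: card_ord.
by split=> [x | x g h]; [rewrite one_e | rewrite (mulE g h)].
Qed.

(** * Solutions *)

Section Solutions.
Variables (X : Type) (r : X * X -> X * X).
Hypothesis sol : solution r.

Lemma solution_sigma_tau x y : sigma r (sigma r x y) (tau r y x) = x.
Proof.
by case: sol => _ _ invr _; rewrite /sigma /tau -surjective_pairing invr.
Qed.

Lemma solution_sigma_comp x y z :
  sigma r x (sigma r y z) = sigma r (sigma r x y) (sigma r (tau r y x) z).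
Proof.
case: sol => _ + _ _ => /(_ (x, y, z))/(congr1 (fun t => t.1.1)).
rewrite /r_id /id_r /= /sigma /tau.
case: (r (x, y)) => a b /=; case: (r (b, z)) => c d /=.
case: (r (y, z)) => a' b' /=; case: (r (x, a')) => e f /=.
by case: (r (f, b')).
Qed.

(** If sigma_x(y) = x, then [r] fixes (x, y): non-degeneracy lets y be recovered
    from x and conversely. *)
Lemma solution_diag_inj x x' y : sigma r x y = x -> sigma r x' y = x' -> x = x'.
Proof.
case: sol => _ _ invr [sbij tbij] xy x'y.
have tau_fix z : sigma r z y = z -> tau r y z = y.
  move=> zy; apply: (bij_inj (sbij z)).
  by rewrite -{1}zy solution_sigma_tau.
apply: (bij_inj (tbij y)).
by rewrite !tau_fix.
Qed.

Lemma permutation_group_subgroup : sym_subgroup (permutation_group r).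
Proof.
case: sol => _ _ _ [sbij _].
split=> [g gG | H [[]] // | g h gG hG H HP | g h gG gh hg H HP].
- apply: (gG (fun f => bijective f)); split; last by move=> _ [x _ <-].
  split=> //; first by exists id.
  + by move=> u v bu bv; apply: bij_comp.
  + by move=> u v _ uv vu; exists u.
- by case: (HP) => -[_ _ HM _] _; apply: HM; [apply: gG | apply: hG].
- by case: (HP) => -[_ _ _ HV] _; apply: (HV g) => //; apply: gG.
Qed.

End Solutions.

Theorem corollary3p6 (X : Type) (r : X * X -> X * X) (n : nat) :
  solution r -> indecomposable r ->
  has_order (permutation_group r) n -> square_free n ->
  uniconnected r.
Proof.
move=> sol indec ordG sfn; split=> // f x0 Gf fx0.
have subG := permutation_group_subgroup sol.
have [gT [to [cardG [to1 toM] Gto toG to_inj]]] := finite_sym_subgroup_action subG ordG.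
have /choice[s sE] x : exists g, to^~ g = sigma r x.
  by apply: toG; apply: sub_smallest; [exact: classical_sets.subset_refl | exists x].
have toE x y : to y (s x) = sigma r x y by rewrite -sE.
have toVE x y : sigma r x (to y (s x)^-1) = y by rewrite -toE -toM mulVg to1.
have tr x y : exists g, to x g = y.
  have [u Gu <-] := indec x y.
  by have [g <-] := toG u Gu; exists g.
have faith g : (forall x, to x g = x) -> g = 1.
  by move=> fixg; apply: to_inj; apply/funext => x; rewrite fixg to1.
have cyc x y : s (to y (s x)^-1) * s x = s (to x (s y)^-1) * s y.
  apply: to_inj; apply/funext => z; rewrite !toM !toE.
  rewrite (solution_sigma_comp sol) toVE; congr (sigma r y (sigma r _ z)).
  have [_ _ _ [sbij _]] := sol; apply: (bij_inj (sbij y)).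
  by rewrite -{1}(toVE x y) (solution_sigma_tau sol) toVE.
have diag : injective (fun x => to x (s x)^-1).
  move=> x x' /= eqx; apply: (solution_diag_inj sol (y := to x (s x)^-1)).
    exact: toVE.
  by rewrite eqx toVE.
have gen (H : {group gT}) : (forall x, s x \in H) -> H = [set: gT] :> {set gT}.
  move=> sH; apply/setP => g; rewrite inE.
  have [|h Hh /to_inj <- //] := Gto g [set u | exists2 h, h \in H & to^~ h = u]%classic.
  split; last by move=> _ [x _ <-]; exists (s x).
  have [Gbij _ _ _] := subG.
  split=> [_ [h _ <-] | | _ _ [h Hh <-] [k Hk <-] | _ u [h Hh <-] hu uh].
  - exact: Gbij.
  - by exists 1 => //; apply/funext => x; rewrite to1.
  - by exists (k * h); rewrite ?groupM //; apply/funext => x; rewrite toM.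
  - exists h^-1; rewrite ?groupV //; apply/funext => x.
    by rewrite -{1}[x]uh -toM mulgV to1.
have [g gf] := toG f Gf.
have -> : f = to^~ 1.
  rewrite -gf -(@stabiliser_trivial X gT to s to1 toM cyc diag gen tr faith x0 _ g) //.
    by rewrite cardG.
  by rewrite -[to x0 g]/((to^~ g) x0) gf.
by apply/funext => x; rewrite to1.
Qed.
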